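(* Let $R$ be a commutative noetherian ring, let $C$ be a semidualizing $R$-module, and let $M$ and $N$ be $R$-modules. If $M,N\in\mathcal{B}_C(R)\cap\mathcal{A}_C(R)$, then one has $$\operatorname{Tor}^{\mathcal{F}_C\mathcal{M}}_i(M,N)\cong\operatorname{Tor}^{\mathcal{F}_C\mathcal{M}}_i(N,M)\quad\text{for all } i\geq 0.$$
   Context: $R$ is a commutative noetherian ring. A finitely generated $R$-module $C$ is semidualizing if the homothety map $R\to\operatorname{Hom}_R(C,C)$ is an isomorphism and $\operatorname{Ext}^i_R(C,C)=0$ for all $i\geq 1$. $\mathcal{F}_C(R)$ is the class of $R$-modules isomorphic to $F\otimes_R C$ with $F$ flat; it is precovering. A proper $\mathcal{F}_C$-resolution of an $R$-module $M$ is a complex $G=(\cdots\to G_1\to G_0\to 0)$ with each $G_i\in\mathcal{F}_C(R)$ together with an augmentation $G_0\to M$ such that $G^+=(\cdots\to G_1\to G_0\to M\to 0)$ is a complex (not necessarily exact) and $\operatorname{Hom}_R(Y,G^+)$ is exact for all $Y\in\mathcal{F}_C(R)$. Then $\operatorname{Tor}^{\mathcal{F}_C\mathcal{M}}_i(M,N):=H_i(G\otimes_R N)$ for $i\geq 0$, independent of the choice of $G$. The Auslander class $\mathcal{A}_C(R)$ is the class of $R$-modules $M$ such that $\operatorname{Tor}^R_i(C,M)=0=\operatorname{Ext}^i_R(C,C\otimes_R M)$ for all $i\geq 1$ and the natural map $M\to\operatorname{Hom}_R(C,C\otimes_R M)$ is an isomorphism. The Bass class $\mathcal{B}_C(R)$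 is the class of $R$-modules $M$ such that $\operatorname{Ext}^i_R(C,M)=0=\operatorname{Tor}^R_i(C,\operatorname{Hom}_R(C,M))$ for all $i\geq 1$ and the natural evaluation map $C\otimes_R\operatorname{Hom}_R(C,M)\to M$ is an isomorphism. *)

(* Defs.v *)
From HB Require Import structures.
From mathcomp Require Import all_boot all_algebra ring_quotient.
From mathcomp Require Import all_classical.

Set Implicit Arguments.
Unset Strict Implicit.
Unset Printing Implicit Defensive.
Import GRing.Theory.
Local Open Scope classical_set_scope.
Local Open Scope quotient_scope.
Local Open Scope ring_scope.

(* Rings are [comPzRingType]s, so that the zero ring is not excluded; modules
   over R are arbitrary [lmodType R]s. *)

Section Submodule.
Variables (R : pzRingType) (V : lmodType R) (S : submodClosed V).

Record submod := Submod { submod_val : V; _ : submod_val \in S }.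

HB.instance Definition _ := [isSub for submod_val].
HB.instance Definition _ := [Choice of submod by <:].
HB.instance Definition _ := [SubChoice_isSubLmodule of submod by <:].

Definition submod_incl : {linear submod -> V} := val.

End Submodule.

Section QuotientModule.
Variables (R : pzRingType) (V : lmodType R) (S : submodClosed V).

(* [submodClosed] does not inherit from [zmodClosed] in the library hierarchy,
   hence this copy of S. *)
Definition zmod_pred : pred V := fun x => x \in S.

Lemma zmod_pred_closed : zmod_closed zmod_pred.
Proof. exact: (GRing.submod_closedB (submodClosedP S)). Qed.
HB.instance Definition _ := GRing.isZmodClosed.Build V zmod_pred zmod_pred_closed.
Definition zmod_of : zmodClosed V := GRing.ZmodClosed.clone V zmod_pred _.

Definition quotmod : Type := Quotient.quot zmod_of.
HB.instance Definition _ := GRing.Zmodule.on quotmod.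

Definition quotmod_pi (x : V) : quotmod :=
  \pi_(Quotient.quot zmod_of) x.
Definition quotmod_repr (x : quotmod) : V :=
  @repr V (Quotient.quot zmod_of) x.

Lemma quotmod_reprK : cancel quotmod_repr quotmod_pi.
Proof. exact: reprK. Qed.

Lemma quotmod_piE x y : (quotmod_pi x = quotmod_pi y) <-> (x - y \in S).
Proof.
rewrite -[x - y \in S]/(x - y \in zmod_of).
by rewrite Quotient.idealrBE; split=> /eqP.
Qed.

Lemma quotmod_piB : zmod_morphism quotmod_pi.
Proof. exact: (raddfB \pi_(Quotient.quot zmod_of)). Qed.
HB.instance Definition _ :=
  GRing.isZmodMorphism.Build V quotmod quotmod_pi quotmod_piB.

Definition quotmod_scale (a : R) (x : quotmod) : quotmod :=
  quotmod_pi (a *: quotmod_repr x).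

Lemma quotmod_pi_scale a x :
  quotmod_pi (a *: x) = quotmod_scale a (quotmod_pi x).
Proof.
apply/quotmod_piE; rewrite -scalerBr rpredZ //; apply/quotmod_piE.
by rewrite quotmod_reprK.
Qed.

Lemma quotmod_scalerA a b x :
  quotmod_scale a (quotmod_scale b x) = quotmod_scale (a * b) x.
Proof. by rewrite -[x]quotmod_reprK -!quotmod_pi_scale scalerA. Qed.

Lemma quotmod_scale1r : left_id 1 quotmod_scale.
Proof. by move=> x; rewrite /quotmod_scale scale1r quotmod_reprK. Qed.

Lemma quotmod_scalerDr : right_distributive quotmod_scale +%R.
Proof.
move=> a x y; rewrite -[x]quotmod_reprK -[y]quotmod_reprK.
by rewrite -raddfD -!quotmod_pi_scale scalerDr raddfD.
Qed.

Lemma quotmod_scalerDl x : {morph quotmod_scale^~ x : a b / a + b}.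
Proof. by move=> a b; rewrite /quotmod_scale scalerDl raddfD. Qed.

HB.instance Definition _ := GRing.Zmodule_isLmodule.Build R quotmod
  quotmod_scalerA quotmod_scale1r quotmod_scalerDr quotmod_scalerDl.

HB.instance Definition _ :=
  GRing.isScalable.Build R V quotmod *:%R quotmod_pi quotmod_pi_scale.

End QuotientModule.

Section KernelImage.
Variables (R : pzRingType) (U V : lmodType R) (f : {linear U -> V}).

Definition submod_ker_pred : pred U := fun x => f x == 0.
Definition submod_im_pred : pred V := fun y => `[< exists x, f x = y >].

Lemma submod_ker_closed : submod_closed submod_ker_pred.
Proof.
split=> [|a x y]; rewrite !unfold_in /submod_ker_pred ?linear0 //.
by move=> /eqP fx /eqP fy; rewrite linearP fx fy scaler0 addr0.
Qed.
HB.instance Definition _ := GRing.isSubmodClosed.Build R U submod_ker_pred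
  (GRing.submod_closed_semi submod_ker_closed).
Definition submod_ker : submodClosed U :=
  GRing.SubmodClosed.clone R U submod_ker_pred _.

Lemma submod_im_closed : submod_closed submod_im_pred.
Proof.
split=> [|a x y]; rewrite !unfold_in.
  by apply/asboolP; exists 0; rewrite linear0.
move=> /asboolP[u <-] /asboolP[v <-]; apply/asboolP.
by exists (a *: u + v); rewrite linearP.
Qed.
HB.instance Definition _ := GRing.isSubmodClosed.Build R V submod_im_pred
  (GRing.submod_closed_semi submod_im_closed).
Definition submod_im : submodClosed V :=
  GRing.SubmodClosed.clone R V submod_im_pred _.

End KernelImage.

Section Preimage.
Variables (R : pzRingType) (U V : lmodType R) (f : {linear U -> V}).
Variable S : submodClosed V.

Definition submod_preim_pred : pred U := fun x => f x \in S.

Lemma submod_preim_closed : submod_closed submod_preim_pred.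
Proof.
have preimE z : (z \in submod_preim_pred) = (f z \in S) by [].
split=> [|a x y]; rewrite !preimE ?linear0 ?rpred0 //.
by move=> fx fy; rewrite linearP rpredD // rpredZ.
Qed.
HB.instance Definition _ := GRing.isSubmodClosed.Build R U submod_preim_pred
  (GRing.submod_closed_semi submod_preim_closed).
Definition submod_preim : submodClosed U :=
  GRing.SubmodClosed.clone R U submod_preim_pred _.

End Preimage.

Section Span.
Variables (R : pzRingType) (V : lmodType R) (A : set V).

Definition submod_span_pred : pred V :=
  fun x => `[< forall S : submodClosed V, (forall a, A a -> a \in S) -> x \in S >].

Lemma submod_span_closed : submod_closed submod_span_pred.
Proof.
split=> [|a x y]; rewrite !unfold_in; first by apply/asboolP=> S _; rewrite rpred0.
move=> /asboolP xS /asboolP yS; apply/asboolP=> S AS.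
by rewrite rpredD ?rpredZ ?xS ?yS.
Qed.
HB.instance Definition _ := GRing.isSubmodClosed.Build R V submod_span_pred
  (GRing.submod_closed_semi submod_span_closed).
Definition submod_span : submodClosed V :=
  GRing.SubmodClosed.clone R V submod_span_pred _.

End Span.

Definition finitely_generated (R : pzRingType) (V : lmodType R) : Prop :=
  exists s : seq V, forall x, x \in submod_span [set` s].

Definition noetherian (R : comPzRingType) : Prop :=
  forall I : submodClosed R^o, exists s : seq R^o, I =i submod_span [set` s].

Definition module_iso (R : pzRingType) (U V : lmodType R) : Prop :=
  exists f : {linear U -> V}, bijective f.

Definition module_zero (R : pzRingType) (V : lmodType R) : Prop :=
  forall x : V, x = 0.

Section FreeModule.
Variables (R : pzRingType) (X : choiceType).

Definition finsupp_pred : pred (X -> R^o) := fun f => `[< finite_set [set x | f x != 0] >].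

Lemma finsupp_submod : submod_closed finsupp_pred.
Proof.
split=> [|a f g]; rewrite !unfold_in.
  by apply/asboolP; apply: (sub_finite_set _ (finite_set0 X)) => x /=; rewrite eqxx.
move=> /asboolP ff /asboolP gf; apply/asboolP.
have fgf : finite_set ([set x | f x != 0] `|` [set x | g x != 0]) by rewrite finite_setU.
apply: (sub_finite_set _ fgf) => x /=; have [fx|] := eqVneq (f x) 0; last by left.
have [gx|] := eqVneq (g x) 0; last by right.
rewrite -[(_ + _) x]/(a * f x + g x) fx gx mulr0 addr0 eqxx //.
Qed.
HB.instance Definition _ := GRing.isSubmodClosed.Build R (X -> R^o) finsupp_pred
  (GRing.submod_closed_semi finsupp_submod).
Definition finsupp : submodClosed (X -> R^o) :=
  GRing.SubmodClosed.clone R (X -> R^o) finsupp_pred _.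

Definition free : lmodType R := submod finsupp.

Definition free_coef (f : free) (x : X) : R := val f x.

Lemma free_gen_subproof (x : X) : (fun y => (y == x)%:R : R^o) \in finsupp.
Proof.
rewrite unfold_in; apply/asboolP; apply: (sub_finite_set _ (finite_set1 x)) => y /=.
by have [->|_] := eqVneq y x; rewrite ?eqxx.
Qed.

Definition free_gen (x : X) : free := Submod (free_gen_subproof x).

Section Lift.
Variables (M : lmodType R) (h : X -> M).

Definition free_lift_fun (f : free) : M :=
  \sum_(x \in [set: X]) free_coef f x *: h x.

Lemma free_lift_linear : linear free_lift_fun.
Proof.
move=> a f g; rewrite /free_lift_fun.
have suppF (u : free) : finite_set [set x | free_coef u x != 0].
  exact/asboolP/(valP u).
pose D := [set x | free_coef f x != 0] `|` [set x | free_coef g x != 0].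
have finD : finite_set D by rewrite finite_setU; split; exact: suppF.
have restr (u : free) : (forall x, ~ D x -> free_coef u x = 0) ->
    \sum_(x \in [set: X]) free_coef u x *: h x =
    \sum_(x \in D) free_coef u x *: h x.
  move=> uD; rewrite -(@fsbig_widen _ _ _ _ D)//.
  by move=> x /= [_ nDx]; rewrite uD // scale0r.
have fD x : ~ D x -> free_coef f x = 0.
  by move=> nD; apply/eqP/negP => fx; apply: nD; left; apply/negP.
have gD x : ~ D x -> free_coef g x = 0.
  by move=> nD; apply/eqP/negP => fx; apply: nD; right; apply/negP.
have coefE x : free_coef (a *: f + g) x = a * free_coef f x + free_coef g x by [].
rewrite !restr //; last by move=> x nD; rewrite coefE fD // gD // mulr0 addr0.
rewrite !fsbig_finite //= scaler_sumr -big_split /=; apply: eq_bigr => x _.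
by rewrite coefE scalerDl scalerA.
Qed.
HB.instance Definition _ :=
  GRing.isLinear.Build R free M *:%R free_lift_fun free_lift_linear.

Definition free_lift : {linear free -> M} := free_lift_fun.

Lemma free_liftE x : free_lift (free_gen x) = h x.
Proof.
rewrite /= /free_lift_fun -(@fsbig_widen _ _ _ _ [set x]) //.
  by rewrite fsbig_set1 /free_coef /= eqxx scale1r.
move=> y [_ /= yx]; rewrite /free_coef /=.
by have [/yx|_] := eqVneq y x; rewrite ?scale0r.
Qed.

End Lift.

Lemma free_decomp (f : free) : free_lift free_gen f = f.
Proof.
have fin : finite_set [set x | free_coef f x != 0] by exact/asboolP/(valP f).
rewrite /= /free_lift_fun -(@fsbig_widen _ _ _ _ [set x | free_coef f x != 0]) //; last first.
  by move=> x /= [_ /negP]; rewrite negbK => /eqP->; rewrite scale0r.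
rewrite fsbig_finite //=; apply: val_inj; apply/funext => y.
rewrite (raddf_sum (submod_incl finsupp)) fct_sumE.
rewrite (eq_bigr (fun x => free_coef f x * (y == x)%:R)) //.
have [fy0|fy] := eqVneq (free_coef f y) 0.
  rewrite -[RHS]/(free_coef f y) fy0 big1 // => x _.
  by have [<-|_] := eqVneq y x; rewrite ?fy0 ?mul0r // mulr0.
rewrite (bigD1_seq y) ?finmap.fset_uniq ?in_fset_set ?inE //=.
rewrite eqxx mulr1 big1 ?addr0 // => x.
by rewrite eq_sym => /negPf ->; rewrite mulr0.
Qed.

Lemma free_ext (M : lmodType R) (f g : {linear free -> M}) :
  (forall x, f (free_gen x) = g (free_gen x)) -> f =1 g.
Proof.
move=> fg z; rewrite -[z]free_decomp /= /free_lift_fun.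
have fin : finite_set [set x | free_coef z x != 0] by exact/asboolP/(valP z).
rewrite -(@fsbig_widen _ _ _ _ [set x | free_coef z x != 0]) //; last first.
  by move=> x /= [_ /negP]; rewrite negbK => /eqP->; rewrite scale0r.
rewrite fsbig_finite //= !linear_sum; apply: eq_bigr => x _.
by rewrite !linearZ_LR fg.
Qed.
End FreeModule.

Section HomModule.
Variables (R : comPzRingType) (U V : lmodType R).

HB.instance Definition _ := gen_eqMixin {linear U -> V}.
HB.instance Definition _ := gen_choiceMixin {linear U -> V}.

Lemma hom_ext (f g : {linear U -> V}) : f =1 g -> f = g.
Proof.
case: f g => [f cf] [g cg] /= /funext fg; case: _ / fg in cg *.
congr GRing.Linear.Pack.
move: cf cg => [[[f0 fD]] [fZ]] [[[f0' fD']] [fZ']].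
by rewrite (Prop_irrelevance f0 f0') (Prop_irrelevance fD fD') (Prop_irrelevance fZ fZ').
Qed.

Definition hom_zero : {linear U -> V} := \0.
Definition hom_add (f g : {linear U -> V}) : {linear U -> V} := f \+ g.
Definition hom_opp (f : {linear U -> V}) : {linear U -> V} := \- f.
Definition hom_scale (a : R) (f : {linear U -> V}) : {linear U -> V} := a \*: f.

Lemma hom_addA : associative hom_add.
Proof. by move=> f g h; apply: hom_ext => x /=; rewrite addrA. Qed.
Lemma hom_addC : commutative hom_add.
Proof. by move=> f g; apply: hom_ext => x /=; rewrite addrC. Qed.
Lemma hom_add0 : left_id hom_zero hom_add.
Proof. by move=> f; apply: hom_ext => x /=; rewrite add0r. Qed.
Lemma hom_addN : left_inverse hom_zero hom_opp hom_add.
Proof. by move=> f; apply: hom_ext => x /=; rewrite addNr. Qed.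

HB.instance Definition _ := GRing.isZmodule.Build {linear U -> V}
  hom_addA hom_addC hom_add0 hom_addN.

Lemma hom_scaleA a b f : hom_scale a (hom_scale b f) = hom_scale (a * b) f.
Proof. by apply: hom_ext => x /=; rewrite scalerA. Qed.
Lemma hom_scale1 : left_id 1 hom_scale.
Proof. by move=> f; apply: hom_ext => x /=; rewrite scale1r. Qed.
Lemma hom_scaleDr : right_distributive hom_scale +%R.
Proof. by move=> a f g; apply: hom_ext => x /=; rewrite scalerDr. Qed.
Lemma hom_scaleDl f : {morph hom_scale^~ f : a b / a + b}.
Proof. by move=> a b; apply: hom_ext => x /=; rewrite scalerDl. Qed.

HB.instance Definition _ := GRing.Zmodule_isLmodule.Build R {linear U -> V}
  hom_scaleA hom_scale1 hom_scaleDr hom_scaleDl.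

End HomModule.

Section HomFunctor.
Variables (R : comPzRingType).

Definition hom_comp (U V W : lmodType R) (g : {linear V -> W}) (f : {linear U -> V}) :
  {linear U -> W} := g \o f.

Section Map.
Variables (U V W : lmodType R).

Lemma hom_postcomp_linear (g : {linear V -> W}) : linear (@hom_comp U V W g).
Proof. by move=> a f f'; apply: hom_ext => x /=; rewrite linearP. Qed.
HB.instance Definition _ g := GRing.isLinear.Build R {linear U -> V} {linear U -> W}
  *:%R (@hom_comp U V W g) (hom_postcomp_linear g).

Definition hom_precomp_fun (f : {linear U -> V}) (g : {linear V -> W}) :=
  hom_comp g f.
Lemma hom_precomp_linear (f : {linear U -> V}) : linear (hom_precomp_fun f).
Proof. by move=> a g g'; apply: hom_ext => x. Qed.
HB.instance Definition _ f := GRing.isLinear.Build R {linear V -> W} {linear U -> W}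
  *:%R (hom_precomp_fun f) (hom_precomp_linear f).

Definition hom_post (g : {linear V -> W}) :
  {linear {linear U -> V} -> {linear U -> W}} := @hom_comp U V W g.
Definition hom_pre (f : {linear U -> V}) :
  {linear {linear V -> W} -> {linear U -> W}} := hom_precomp_fun f.

End Map.

Section Flip.
Variables (U V W : lmodType R) (b : {linear U -> {linear V -> W}}).

Definition flip_fun (v : V) (u : U) : W := b u v.
Lemma flip_fun_linear v : linear (flip_fun v).
Proof. by move=> a x y; rewrite /flip_fun linearP. Qed.
HB.instance Definition _ v := GRing.isLinear.Build R U W *:%R (flip_fun v)
  (flip_fun_linear v).

Definition flip_lin (v : V) : {linear U -> W} := flip_fun v.
Lemma flip_lin_linear : linear flip_lin.
Proof. by move=> a x y; apply: hom_ext => u; rewrite /= /flip_fun linearP. Qed.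
HB.instance Definition _ := GRing.isLinear.Build R V {linear U -> W} *:%R flip_lin
  flip_lin_linear.

Definition flip : {linear V -> {linear U -> W}} := flip_lin.

End Flip.
End HomFunctor.

Section TensorProduct.
Variables (R : comPzRingType) (M N : lmodType R).

Definition tensor_relations : set (free R (M * N)%type) :=
  [set z | exists a m m' n, z = free_gen R (a *: m + m', n)
             - (a *: free_gen R (m, n) + free_gen R (m', n))] `|`
  [set z | exists a m n n', z = free_gen R (m, a *: n + n')
             - (a *: free_gen R (m, n) + free_gen R (m, n'))].

Definition tensor : lmodType R := quotmod (submod_span tensor_relations).

Definition tens_fun (m : M) (n : N) : tensor := quotmod_pi _ (free_gen R (m, n)).

Lemma tens_fun_linear m : linear (tens_fun m).
Proof.
move=> a n n'; rewrite /tens_fun -linearP; apply/quotmod_piE.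
by apply/asboolP=> S; apply; right; exists a, m, n, n'.
Qed.
HB.instance Definition _ m := GRing.isLinear.Build R N tensor *:%R (tens_fun m)
  (tens_fun_linear m).

Definition tens_lin (m : M) : {linear N -> tensor} := tens_fun m.
Lemma tens_lin_linear : linear tens_lin.
Proof.
move=> a m m'; apply: hom_ext => n.
rewrite -[RHS]/(a *: tens_fun m n + tens_fun m' n) /= /tens_fun -linearP.
apply/quotmod_piE; apply/asboolP=> S; apply; left.
by exists a, m, m', n.
Qed.
HB.instance Definition _ := GRing.isLinear.Build R M {linear N -> tensor} *:%R tens_lin
  tens_lin_linear.

(* The universal bilinear map; bilinear maps are curried throughout. *)
Definition tens : {linear M -> {linear N -> tensor}} := tens_lin.

Section Lift.
Variables (P : lmodType R) (b : {linear M -> {linear N -> P}}).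

Definition tensor_lift_fun (t : tensor) : P :=
  free_lift (fun mn : M * N => b mn.1 mn.2) (quotmod_repr t).

Lemma tensor_lift_fun_pi x :
  tensor_lift_fun (quotmod_pi _ x) = free_lift (fun mn : M * N => b mn.1 mn.2) x.
Proof.
pose g := free_lift (fun mn : M * N => b mn.1 mn.2).
have g0 z : z \in submod_span tensor_relations -> z \in submod_ker g.
  move=> /asboolP; apply=> {}z [] [a [p [q [r ->]]]]; apply/eqP;
    rewrite linearB linearP !free_liftE linearP; exact: subrr.
apply/eqP; rewrite -subr_eq0 -linearB; apply: g0; apply/quotmod_piE.
exact: quotmod_reprK.
Qed.

Lemma tensor_lift_linear : linear tensor_lift_fun.
Proof.
move=> a x y; rewrite -[x]quotmod_reprK -[y]quotmod_reprK -linearP.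
by rewrite !tensor_lift_fun_pi linearP.
Qed.
HB.instance Definition _ := GRing.isLinear.Build R tensor P *:%R tensor_lift_fun
  tensor_lift_linear.

Definition tensor_lift : {linear tensor -> P} := tensor_lift_fun.

Lemma tensor_liftE m n : tensor_lift (tens m n) = b m n.
Proof. by rewrite /= /tens_fun tensor_lift_fun_pi free_liftE. Qed.

End Lift.

Lemma tensor_ext (P : lmodType R) (f g : {linear tensor -> P}) :
  (forall m n, f (tens m n) = g (tens m n)) -> f =1 g.
Proof.
move=> fg t; rewrite -[t]quotmod_reprK.
pose p : {linear _ -> tensor} := quotmod_pi (submod_span tensor_relations).
by apply: (@free_ext _ _ _ (f \o p) (g \o p)) => -[m n]; exact: fg.
Qed.
End TensorProduct.

Definition tensor_map (R : comPzRingType) (M M' : lmodType R) (f : {linear M -> M'})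
    (N : lmodType R) : {linear tensor M N -> tensor M' N} :=
  tensor_lift (hom_comp (tens M' N) f).

Lemma tensor_mapE (R : comPzRingType) (M M' : lmodType R) (f : {linear M -> M'})
    (N : lmodType R) m n : tensor_map f N (tens M N m n) = tens M' N (f m) n.
Proof. exact: tensor_liftE. Qed.

Definition flat (R : comPzRingType) (F : lmodType R) : Prop :=
  forall (A B : lmodType R) (f : {linear A -> B}),
    injective f -> injective (tensor_map f F).

Section Complexes.
Variables (R : comPzRingType).

Record chain_complex := ChainComplex {
  chain_obj :> nat -> lmodType R;
  bd : forall n, {linear chain_obj n.+1 -> chain_obj n};
  bd_bd : forall n x, bd n (bd n.+1 x) = 0 }.

Record cochain_complex := CochainComplex {
  cochain_obj :> nat -> lmodType R;
  cobd : forall n, {linear cochain_obj n -> cochain_obj n.+1};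
  cobd_cobd : forall n x, cobd n.+1 (cobd n x) = 0 }.

Definition cycles (X : chain_complex) (n : nat) : submodClosed (X n) :=
  match n with
  | 0 => submod_ker (hom_zero (X 0) (X 0))
  | m.+1 => submod_ker (bd X m)
  end.
Definition boundaries (X : chain_complex) (n : nat) : submodClosed (X n) :=
  submod_im (bd X n).

Definition cocycles (X : cochain_complex) (n : nat) : submodClosed (X n) :=
  submod_ker (cobd X n).
Definition coboundaries (X : cochain_complex) (n : nat) : submodClosed (X n) :=
  match n with
  | 0 => submod_im (hom_zero (X 0) (X 0))
  | m.+1 => submod_im (cobd X m)
  end.

(* The quotient Z / (Z :&: B). *)
Definition subquotient (V : lmodType R) (Z B : submodClosed V) : lmodType R :=
  quotmod (submod_preim (submod_incl Z) B).

Lemma subquotient_zeroP (V : lmodType R) (Z B : submodClosed V) :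
  module_zero (subquotient Z B) <-> forall x, x \in Z -> x \in B.
Proof.
split=> [Q0 x Zx | ZB q].
  have /quotmod_piE : quotmod_pi (submod_preim (submod_incl Z) B) (Submod Zx) = quotmod_pi _ 0.
    by rewrite [LHS]Q0 linear0.
  by rewrite subr0.
rewrite -[q]quotmod_reprK -(linear0 (quotmod_pi (submod_preim (submod_incl Z) B))).
by apply/quotmod_piE; rewrite subr0; apply: ZB; exact: valP.
Qed.

Definition homology (X : chain_complex) (n : nat) : lmodType R :=
  subquotient (cycles X n) (boundaries X n).
Definition cohomology (X : cochain_complex) (n : nat) : lmodType R :=
  subquotient (cocycles X n) (coboundaries X n).

Definition exact_complex (X : chain_complex) : Prop := forall n, module_zero (homology X n).

Lemma tensor_map_bd_bd (X : chain_complex) (N : lmodType R) n x :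
  tensor_map (bd X n) N (tensor_map (bd X n.+1) N x) = 0.
Proof.
pose f : {linear _ -> _} := hom_comp (tensor_map (bd X n) N) (tensor_map (bd X n.+1) N).
rewrite -[LHS]/(f x); apply: (tensor_ext (g := \0)) => m y.
rewrite -[LHS]/(tensor_map (bd X n) N (tensor_map (bd X n.+1) N (tens _ _ m y))).
by rewrite !tensor_liftE -[LHS]/(tens _ _ (bd X n (bd X n.+1 m)) y) bd_bd linear0.
Qed.

Definition complex_tensor (X : chain_complex) (N : lmodType R) : chain_complex :=
  @ChainComplex (fun n => tensor (X n) N) (fun n => tensor_map (bd X n) N)
    (@tensor_map_bd_bd X N).

Lemma hom_post_bd_bd (Y : lmodType R) (X : chain_complex) n x :
  hom_post Y (bd X n) (hom_post Y (bd X n.+1) x) = 0.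
Proof. by apply: hom_ext => y; rewrite /= bd_bd. Qed.

Definition complex_hom_post (Y : lmodType R) (X : chain_complex) : chain_complex :=
  @ChainComplex (fun n => {linear Y -> X n}) (fun n => hom_post Y (bd X n))
    (@hom_post_bd_bd Y X).

Lemma hom_pre_bd_bd (X : chain_complex) (N : lmodType R) n x :
  hom_pre N (bd X n.+1) (hom_pre N (bd X n) x) = 0.
Proof. by apply: hom_ext => y; rewrite /= bd_bd linear0. Qed.

Definition complex_hom_pre (X : chain_complex) (N : lmodType R) : cochain_complex :=
  @CochainComplex (fun n => {linear X n -> N}) (fun n => hom_pre N (bd X n))
    (@hom_pre_bd_bd X N).

(* The canonical free resolution of M: F_n is the free module on the underlying
   set of the n-th syzygy K_n, where K_0 = M and K_{n+1} = ker (F_n -> K_n). *)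
Definition free_cover (M : lmodType R) : {linear free R M -> M} := free_lift id.

Definition syzygy (M : lmodType R) : lmodType R := submod (submod_ker (free_cover M)).

Fixpoint nth_syzygy (M : lmodType R) (n : nat) : lmodType R :=
  if n is m.+1 then syzygy (nth_syzygy M m) else M.

Definition free_resolution_bd (M : lmodType R) (n : nat) :
    {linear free R (nth_syzygy M n.+1) -> free R (nth_syzygy M n)} :=
  hom_comp (submod_incl (submod_ker (free_cover (nth_syzygy M n))))
    (free_cover (nth_syzygy M n.+1)).

Lemma free_resolution_bd_bd M n x :
  free_resolution_bd M n (free_resolution_bd M n.+1 x) = 0.
Proof.
have : free_cover _ (submod_incl _ (free_cover (nth_syzygy M n.+2) x)) = 0.
  by apply/eqP; exact: (valP (free_cover (nth_syzygy M n.+2) x)).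
by move=> cov0; rewrite /= -[RHS](linear0 (submod_incl (submod_ker (free_cover (nth_syzygy M n))))) -[in RHS]cov0.
Qed.

Definition free_resolution (M : lmodType R) : chain_complex :=
  ChainComplex (@free_resolution_bd_bd M).

Definition Tor (i : nat) (M N : lmodType R) : lmodType R :=
  homology (complex_tensor (free_resolution M) N) i.

Definition Ext (i : nat) (M N : lmodType R) : lmodType R :=
  cohomology (complex_hom_pre (free_resolution M) N) i.

Definition homothety (C : lmodType R) (r : R) : {linear C -> C} :=
  hom_scale r idfun.

Lemma homothetyE (C : lmodType R) r c : homothety C r c = r *: c.
Proof. by []. Qed.

Definition semidualizing (C : lmodType R) : Prop :=
  [/\ finitely_generated C, bijective (homothety C)
    & forall i, (1 <= i)%N -> module_zero (Ext i C C)].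

Definition auslander_map (C M : lmodType R) : {linear M -> {linear C -> tensor C M}} :=
  flip (tens C M).

Definition bass_map (C M : lmodType R) : {linear tensor C {linear C -> M} -> M} :=
  tensor_lift (flip (idfun : {linear {linear C -> M} -> {linear C -> M}})).

Lemma auslander_mapE (C M : lmodType R) m c : auslander_map C M m c = tens C M c m.
Proof. by []. Qed.

Lemma bass_mapE (C M : lmodType R) c f : bass_map C M (tens _ _ c f) = f c.
Proof. exact: tensor_liftE. Qed.

Definition auslander_class (C M : lmodType R) : Prop :=
  (forall i, (1 <= i)%N ->
     module_zero (Tor i C M) /\ module_zero (Ext i C (tensor C M))) /\
  bijective (auslander_map C M).

Definition bass_class (C M : lmodType R) : Prop :=
  (forall i, (1 <= i)%N ->
     module_zero (Ext i C M) /\ module_zero (Tor i C {linear C -> M})) /\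
  bijective (bass_map C M).

Definition flat_C (C X : lmodType R) : Prop :=
  exists F : lmodType R, flat F /\ module_iso (tensor F C) X.

Record augmented_complex (M : lmodType R) := AugmentedComplex {
  aug_complex :> chain_complex;
  aug : {linear aug_complex 0 -> M};
  aug_bd : forall x, aug (bd aug_complex 0 x) = 0 }.

(* G^+ as a complex with M in degree 0 and G_n in degree n+1. *)
Section Plus.
Variables (M : lmodType R) (G : augmented_complex M).

Definition plus_obj (n : nat) : lmodType R := if n is m.+1 then G m else M.

Definition plus_bd (n : nat) : {linear plus_obj n.+1 -> plus_obj n} :=
  match n with
  | 0 => aug G
  | m.+1 => bd G m
  end.

Lemma plus_bd_bd n x : plus_bd n (plus_bd n.+1 x) = 0.
Proof. by case: n x => [|n] x; [exact: aug_bd | exact: bd_bd]. Qed.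

Definition plus_complex : chain_complex := ChainComplex plus_bd_bd.
End Plus.

Definition proper_flat_C_resolution (C M : lmodType R) (G : augmented_complex M) : Prop :=
  (forall n, flat_C C (G n)) /\
  (forall Y, flat_C C Y -> exact_complex (complex_hom_post Y (plus_complex G))).

(* The relative Tor of M and N, for G a proper resolution of M. Up to isomorphism
   it does not depend on G, which is kept as an argument: a statement about the
   relative Tor is a statement about every such G. *)
Definition relative_Tor (M : lmodType R) (G : augmented_complex M) (N : lmodType R)
    (i : nat) : lmodType R :=
  homology (complex_tensor G N) i.

End Complexes.

(* Main.v *)
From HB Require Import structures.
From mathcomp Require Import all_boot all_algebra.
From mathcomp Require Import all_classical.
Require Import Defs.

(** The relative Tor agrees with the absolute one: if M lies in the Bass class and
    N in the Auslander class, then relative_Tor G N i is isomorphic to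
    Tor i N M ([relative_Tor_Tor]). Under the hypotheses of the theorem this applies
    to (M, N) and to (N, M), and the absolute Tor is symmetric ([Tor_sym]).

    Let G be a proper F_C-resolution of M, with G_n = F_n (x) C and F_n flat. The
    first point is that G is an honest resolution of M
    ([proper_flat_C_resolution_exact]), which properness alone does not give. Since
    R is noetherian, C is finitely presented, and from R = Hom(C, C) one gets
    F = Hom(C, C (x) F) for every flat F ([flat_auslander_map_bij]). Hence
    Hom(C, G) is a flat resolution of Hom(C, M); as Tor(C, Hom(C, M)) vanishes, it
    stays exact after tensoring with C, and C (x) Hom(C, -) is the identity on M
    and on every G_n. The second point is that every G_n is acyclic for
    - (x) N, because Tor(C, N) vanishes and F_n is flat. A resolution of M by
    acyclic modules computes Tor.

    Each comparison of two ways to compute a Tor, including the symmetry, is an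
    instance of one statement about a double complex K (x) L with exact rows and
    columns ([double_complex_iso], [balance]). No total complex or spectral
    sequence is formed: the elements killed by both differentials, modulo the image
    of their composite, form a group that one diagram chase shows to be constant
    along an antidiagonal ([bihomology_step]), and at the two ends of the
    antidiagonal this group is the homology of one of the two edges. *)

Set Implicit Arguments.
Unset Strict Implicit.
Unset Printing Implicit Defensive.
Import GRing.Theory.
Local Open Scope ring_scope.

(** * Linear maps and subquotients *)

Section LinearMaps.
Variable R : comPzRingType.
Implicit Types U V W : lmodType R.

Definition linear_map U V (f : U -> V) (lin_f : linear f) : {linear U -> V} :=
  HB.pack f (GRing.isLinear.Build R U V *:%R f lin_f).

Lemma linear_mapE U V (f : U -> V) (lin_f : linear f) x : linear_map lin_f x = f x.
Proof. by []. Qed.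

Lemma linear_bijective U V (f : {linear U -> V}) :
  (forall x, f x = 0 -> x = 0) -> (forall y, exists x, f x = y) -> bijective f.
Proof.
move=> ker0 surj; have [g fg] := choice surj; exists g => // x.
by apply/subr0_eq/ker0; rewrite linearB fg subrr.
Qed.

Lemma linear_bijective_ker U V (f : {linear U -> V}) : bijective f -> forall x, f x = 0 -> x = 0.
Proof. by move=> [g fK _] x fx0; rewrite -[x]fK fx0 -(linear0 f) fK. Qed.

Lemma linear_inverse U V (f : {linear U -> V}) :
  bijective f -> exists g : {linear V -> U}, cancel f g /\ cancel g f.
Proof.
move=> [g fK gK]; have lin_g : linear g.
  by move=> a x y; rewrite -{1}[x]gK -{1}[y]gK -linearP fK.
by exists (linear_map lin_g).
Qed.

Lemma module_iso_sym U V : module_iso U V -> module_iso V U.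
Proof. by move=> [f /linear_inverse[g [fK gK]]]; exists g; exists f. Qed.

Lemma module_iso_trans U V W : module_iso U V -> module_iso V W -> module_iso U W.
Proof. by move=> [f bf] [g bg]; exists (hom_comp g f); exact: bij_comp. Qed.

Lemma module_iso_zero U V : module_iso U V -> module_zero U -> module_zero V.
Proof. by move=> [f [g _ gK]] U0 y; rewrite -[y]gK (U0 (g y)) linear0. Qed.

Lemma linear_factor U V W (g : {linear U -> V}) (h : {linear U -> W}) :
    (forall y, exists x, g x = y) -> (forall x, g x = 0 -> h x = 0) ->
  exists h' : {linear V -> W}, forall x, h' (g x) = h x.
Proof.
move=> surj ker; have [s gs] := choice surj.
have hs x y : g x = g y -> h x = h y.
  by move=> e; apply/subr0_eq; rewrite -linearB ker // linearB e subrr.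
have lin : linear (h \o s).
  by move=> a x y; rewrite /= -linearP; apply: hs; rewrite linearP !gs.
by exists (linear_map lin) => x; apply: hs; rewrite gs.
Qed.

Section Subquotient.
Variables (V W : lmodType R) (Z B : submodClosed V) (Z' B' : submodClosed W).

(** An isomorphism of subquotients described by a linear relation instead of a
    map: this is the form in which diagram chases produce their result, the
    lifts made along the way being determined only up to boundaries. *)
Lemma subquotient_iso (S : V -> W -> Prop) :
    (forall a v w v' w', S v w -> S v' w' -> S (a *: v + v') (a *: w + w')) ->
    (forall v, v \in Z -> exists2 w, w \in Z' & S v w) ->
    (forall w, w \in Z' -> exists2 v, v \in Z & S v w) ->
    (forall v w, v \in Z -> w \in Z' -> S v w -> v \in B <-> w \in B') ->
  module_iso (subquotient Z B) (subquotient Z' B').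
Proof.
move=> lin tot surj bnd.
pose pi : {linear submod Z -> subquotient Z B} := quotmod_pi (submod_preim (submod_incl Z) B).
pose pi' : {linear submod Z' -> subquotient Z' B'} := quotmod_pi (submod_preim (submod_incl Z') B').
have piK q : pi (quotmod_repr q) = q by exact: quotmod_reprK.
have piK' q : pi' (quotmod_repr q) = q by exact: quotmod_reprK.
have piE (x y : submod Z) : pi x = pi y <-> val x - val y \in B by exact: quotmod_piE.
have piE' (x y : submod Z') : pi' x = pi' y <-> val x - val y \in B' by exact: quotmod_piE.
have bnd' (x y : submod Z) (x' y' : submod Z') : S (val x) (val x') -> S (val y) (val y') ->
    pi x = pi y <-> pi' x' = pi' y'.
  move=> Sx Sy; have Sxy : S (val (x - y)) (val (x' - y')).
    have := lin (-1) _ _ _ _ Sy Sx; rewrite !scaleN1r ![- _ + _]addrC.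
    by rewrite -[val x - _]/(val (x - y)) -[val x' - _]/(val (x' - y')).
  split=> [/piE|/piE'] /(bnd _ _ (valP (x - y)) (valP (x' - y')) Sxy) h.
    exact/piE'.
  exact/piE.
have ex (q : subquotient Z B) : exists w : submod Z', S (val (quotmod_repr q)) (val w).
  have [w Zw Sw] := tot _ (valP (quotmod_repr q)).
  by exists (Submod Zw).
have [f Sf] := choice ex; pose F q := pi' (f q).
have linF : linear F.
  move=> a x y; rewrite /F -linearP.
  apply/(bnd' (quotmod_repr (a *: x + y)) (a *: quotmod_repr x + quotmod_repr y)).
  - exact: Sf.
  - exact: (lin a _ _ _ _ (Sf x) (Sf y)).
  - by rewrite linearP !piK.
have S0 : S (val (0 : submod Z)) (val (0 : submod Z')).
  have [w _ Sw] := tot _ (valP (0 : submod Z)).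
  by have := lin (-1) _ _ _ _ Sw Sw; rewrite !scaleN1r !addNr.
exists (linear_map linF); apply: linear_bijective => [q|q].
  rewrite linear_mapE /F -(linear0 pi') => /(bnd' _ _ _ _ (Sf q) S0).
  by rewrite piK linear0.
have [v Zv Sv] := surj _ (valP (quotmod_repr q)).
exists (pi (Submod Zv)); rewrite linear_mapE -[RHS]piK'.
apply/(bnd' (quotmod_repr (pi (Submod Zv))) (Submod Zv) _ (quotmod_repr q)) => //.
Qed.
End Subquotient.
End LinearMaps.

(** * Double complexes with exact rows and columns *)

Section SubmoduleOfPredicate.
Variables (R : comPzRingType) (V : lmodType R) (P : V -> Prop).
Hypotheses (P0 : P 0) (PD : forall a x y, P x -> P y -> P (a *: x + y)).

Definition submod_of_pred : pred V := fun x => `[< P x >].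

Lemma submod_of_closed : submod_closed submod_of_pred.
Proof.
split=> [|a x y]; rewrite !unfold_in; first exact/asboolP.
by move=> /asboolP Px /asboolP Py; apply/asboolP; apply: PD.
Qed.

Definition submod_of : submodClosed V :=
  HB.pack submod_of_pred (GRing.isSubmodClosed.Build R V submod_of_pred
    (GRing.submod_closed_semi submod_of_closed)).

Lemma submod_ofP x : reflect (P x) (x \in submod_of).
Proof. exact: asboolP. Qed.
End SubmoduleOfPredicate.

Lemma submod_kerP (R : comPzRingType) (U V : lmodType R) (f : {linear U -> V}) x :
  reflect (f x = 0) (x \in submod_ker f).
Proof. exact: eqP. Qed.

Lemma submod_imP (R : comPzRingType) (U V : lmodType R) (f : {linear U -> V}) y :
  reflect (exists x, f x = y) (y \in submod_im f).
Proof. exact: asboolP. Qed.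

(** A first-quadrant double complex in which index 0 is the augmentation in
    either direction. All its rows and columns are exact, except possibly the
    column p = 0 and the row q = 0, whose homologies are to be compared. *)
Section DoubleComplex.
Variables (R : comPzRingType) (D : nat -> nat -> lmodType R).
Variables (dh : forall p q, {linear D p.+1 q -> D p q}).
Variables (dv : forall p q, {linear D p q.+1 -> D p q}).
Hypothesis dh_dh : forall p q x, dh p q (dh p.+1 q x) = 0.
Hypothesis dv_dv : forall p q x, dv p q (dv p q.+1 x) = 0.
Hypothesis dh_dv : forall p q x, dh p q (dv p.+1 q x) = dv p q (dh p q.+1 x).
Hypothesis dv_surj : forall p y, exists x, dv p.+1 0 x = y.
Hypothesis dv_exact : forall p q y, dv p.+1 q y = 0 -> exists x, dv p.+1 q.+1 x = y.
Hypothesis dh_surj : forall q y, exists x, dh 0 q.+1 x = y.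
Hypothesis dh_exact : forall p q y, dh p q.+1 y = 0 -> exists x, dh p.+1 q.+1 x = y.

(** The corner D 0 0 is disregarded: the differentials into it come from the two
    augmentations, and homology in degree 0 of the row and of the column to be
    compared is a cokernel. *)
Definition hcycle p q : D p q -> Prop :=
  if p is p'.+1 then fun x => (0 < p' + q)%N -> dh p' q x = 0 else fun=> True.
Definition vcycle p q : D p q -> Prop :=
  if q is q'.+1 then fun x => (0 < p + q')%N -> dv p q' x = 0 else fun=> True.

Lemma bicycle0 p q : hcycle (0 : D p q) /\ vcycle (0 : D p q).
Proof. by split; [case: p | case: q] => //= n _; rewrite linear0. Qed.

Lemma bicycleD p q a (x y : D p q) :
  hcycle x /\ vcycle x -> hcycle y /\ vcycle y -> hcycle (a *: x + y) /\ vcycle (a *: x + y).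
Proof.
move=> [hx vx] [hy vy]; split.
  by case: p x y hx hy {vx vy} => //= p x y hx hy pq; rewrite linearP hx ?hy ?scaler0 ?addr0.
by case: q x y vx vy {hx hy} => //= q x y vx vy pq; rewrite linearP vx ?vy ?scaler0 ?addr0.
Qed.

Definition bicycles p q : submodClosed (D p q) := submod_of (@bicycle0 p q) (@bicycleD p q).

Lemma bicyclesP p q z : reflect (hcycle z /\ vcycle z) (z \in bicycles p q).
Proof. exact: (submod_ofP (@bicycle0 p q) (@bicycleD p q)). Qed.

Definition biboundaries p q : submodClosed (D p q) :=
  submod_im (hom_comp (dh p q) (dv p.+1 q)).

(** Dividing the elements killed by both differentials by the image of their
    composite gives a group that does not change along an antidiagonal, which
    makes it interpolate between the two homologies. *)
Definition bihomology p q := subquotient (bicycles p q) (biboundaries p q).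

(** The connecting relation z ~ y, when z and y are the two images of one element
    x of D p.+1 q.+1. Another choice of x changes y by an element of the image of
    the composite differential, as the column through x is exact, and the same holds for z. *)
Lemma bihomology_step p q : module_iso (bihomology p.+1 q) (bihomology p q.+1).
Proof.
apply: (@subquotient_iso _ _ _ _ _ _ _
  (fun z y => exists2 x : D p.+1 q.+1, dv p.+1 q x = z & dh p q.+1 x = y)).
- by move=> a z y z' y' [x <- <-] [x' <- <-]; exists (a *: x + x'); rewrite linearP.
- move=> z /bicyclesP[/= hz vz].
  have [x xz] : exists x, dv p.+1 q x = z.
    case: q z hz vz => [|q] z hz vz; first exact: dv_surj.
    by apply: dv_exact; apply: vz.
  exists (dh p q.+1 x); last by exists x.
  apply/bicyclesP; split=> /= [|pq]; last by rewrite -dh_dv xz hz.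
  by case: p {xz hz vz z} x => //= p x _; rewrite dh_dh.
- move=> y /bicyclesP[/= hy vy].
  have [x xy] : exists x, dh p q.+1 x = y.
    case: p y hy vy => [|p] y hy vy; first exact: dh_surj.
    by apply: dh_exact; apply: hy; rewrite addnS.
  exists (dv p.+1 q x); last by exists x.
  apply/bicyclesP; split=> /= [pq|]; first by rewrite dh_dv xy vy.
  by case: q {xy hy vy y} x => //= q x _; rewrite dv_dv.
- move=> z y _ _ [x <- <-]; split=> /submod_imP[w /= xw]; apply/submod_imP.
    have /dv_exact[x' x'E] : dv p.+1 q (x - dh p.+1 q.+1 w) = 0.
      by rewrite linearB -xw dh_dv subrr.
    by exists x'; rewrite /= x'E linearB dh_dh subr0.
  have /dh_exact[x' x'E] : dh p q.+1 (x - dv p.+1 q.+1 w) = 0.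
    by rewrite linearB -xw subrr.
  by exists x'; rewrite /= dh_dv x'E linearB dv_dv subr0.
Qed.

Lemma bihomology_antidiagonal p q : module_iso (bihomology p q) (bihomology 0 (p + q)).
Proof.
elim: p q => [|p IHp] q; first by exists idfun; exists idfun.
by rewrite addSnnS; apply: module_iso_trans (bihomology_step p q) (IHp _).
Qed.

Definition bottom_row : chain_complex R :=
  @ChainComplex R (fun p => D p.+1 0) (fun p => dh p.+1 0) (fun p => @dh_dh p.+1 0).
Definition left_column : chain_complex R :=
  @ChainComplex R (fun q => D 0 q.+1) (fun q => dv 0 q.+1) (fun q => @dv_dv 0 q.+1).

(** On the bottom row the image of the composite is the image of the horizontal
    differential, since the columns p > 0 are surjective onto that row. *)
Lemma homology_bottom_row p : module_iso (homology bottom_row p) (bihomology p.+1 0).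
Proof.
apply: (@subquotient_iso _ _ _ _ _ _ _ eq) => [a v w v' w' -> -> //|v Zv|v Zv|v w _ _ <-].
- exists v => //; apply/bicyclesP; split=> //= p0.
  by case: p v Zv p0 => // p v /submod_kerP.
- exists v => //; case: p v Zv => [|p] v /bicyclesP[/= hv _]; first exact/submod_kerP.
  by apply/submod_kerP; apply: hv; rewrite addn0.
split=> /submod_imP[x xv]; apply/submod_imP; last by exists (dv p.+2 0 x).
by have [x' x'E] := dv_surj x; exists x'; rewrite /= x'E.
Qed.

Lemma homology_left_column q : module_iso (homology left_column q) (bihomology 0 q.+1).
Proof.
apply: (@subquotient_iso _ _ _ _ _ _ _ eq) => [a v w v' w' -> -> //|v Zv|v Zv|v w _ _ <-].
- exists v => //; apply/bicyclesP; split=> //= q0.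
  by case: q v Zv q0 => // q v /submod_kerP.
- exists v => //; case: q v Zv => [|q] v /bicyclesP[/= _ hv]; first exact/submod_kerP.
  by apply/submod_kerP; apply: hv; rewrite add0n.
split=> /submod_imP[x xv]; apply/submod_imP.
  by have [x' x'E] := dh_surj x; exists x'; rewrite /= dh_dv x'E.
by exists (dh 0 q.+2 x); rewrite -xv /= dh_dv.
Qed.

Lemma double_complex_iso n : module_iso (homology bottom_row n) (homology left_column n).
Proof.
apply: module_iso_trans (homology_bottom_row n) _.
apply: module_iso_trans (bihomology_antidiagonal n.+1 0) _; rewrite addn0.
exact: module_iso_sym (homology_left_column n).
Qed.
End DoubleComplex.

(** * Tensor products: functoriality and exactness *)

Section Tensor.
Variable R : comPzRingType.
Implicit Types M N P A B : lmodType R.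

Section BilinearMap.
Variables (M N P : lmodType R) (b : M -> N -> P).
Hypotheses (lin_r : forall m, linear (b m)) (lin_l : forall n, linear (b^~ n)).

Lemma bilinear_map_subproof : linear (fun m => linear_map (lin_r m)).
Proof. by move=> a m m'; apply: hom_ext => n; rewrite /= lin_l. Qed.

Definition bilinear_map : {linear M -> {linear N -> P}} := linear_map bilinear_map_subproof.
End BilinearMap.

Lemma tensor_ind M N (Q : tensor M N -> Prop) :
  (forall m n, Q (tens M N m n)) -> (forall s t, Q s -> Q t -> Q (s + t)) -> forall t, Q t.
Proof.
move=> Qtens QD t.
pose pi : {linear free R (M * N)%type -> tensor M N} := quotmod_pi (submod_span _).
have Q0 : Q 0 by rewrite -(linear0 (tens M N 0)); apply: Qtens.
rewrite -[t]quotmod_reprK -[quotmod_repr t]free_decomp.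
rewrite -[quotmod_pi _ _]/(pi _) /= /free_lift_fun.
have [fin|inf] := pselect (finite_set [set x | free_coef (quotmod_repr t) x != 0]%classic).
  rewrite -(@fsbig_widen _ _ _ _ [set x | free_coef (quotmod_repr t) x != 0]%classic) //; last first.
    by move=> x /= [_ /negP]; rewrite negbK => /eqP->; rewrite scale0r.
  rewrite fsbig_finite //= linear_sum; apply: (big_ind Q) => // -[m n] _.
  rewrite linearZ_LR -[pi _]/(tens M N m n) -linearZ_LR; exact: Qtens.
by case: inf; apply/asboolP/(valP (quotmod_repr t)).
Qed.

Lemma tensor_map_comp A B P (f : {linear A -> B}) (g : {linear B -> P}) N t :
  tensor_map g N (tensor_map f N t) = tensor_map (hom_comp g f) N t.
Proof.
apply: (@tensor_ext _ _ _ _ (hom_comp (tensor_map g N) (tensor_map f N))) => a n.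
by rewrite -[LHS]/(tensor_map g N (tensor_map f N (tens _ _ a n))) !tensor_mapE.
Qed.

Lemma tensor_map_id A N t : tensor_map (idfun : {linear A -> A}) N t = t.
Proof. by apply: (tensor_ext (g := idfun)) => a n; rewrite tensor_mapE. Qed.

Lemma tensor_map_ext A B (f g : {linear A -> B}) N t :
  f =1 g -> tensor_map f N t = tensor_map g N t.
Proof. by move=> /hom_ext ->. Qed.

Definition swap M N : {linear tensor M N -> tensor N M} := tensor_lift (flip (tens N M)).

Lemma swapE M N m n : swap M N (tens M N m n) = tens N M n m.
Proof. exact: tensor_liftE. Qed.

Lemma swapK M N : cancel (swap M N) (swap N M).
Proof.
move=> t; apply: (@tensor_ext _ _ _ _ (hom_comp (swap N M) (swap M N)) idfun) => m n.
by rewrite -[LHS]/(swap N M (swap M N _)) !swapE.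
Qed.

Definition tensor_mapr M N N' (g : {linear N -> N'}) : {linear tensor M N -> tensor M N'} :=
  hom_comp (swap N' M) (hom_comp (tensor_map g M) (swap M N)).

Lemma tensor_mapr_def M N N' (g : {linear N -> N'}) t :
  tensor_mapr M g t = swap _ _ (tensor_map g M (swap _ _ t)).
Proof. by []. Qed.

Lemma tensor_maprE M N N' (g : {linear N -> N'}) m n :
  tensor_mapr M g (tens M N m n) = tens M N' m (g n).
Proof. by rewrite tensor_mapr_def swapE tensor_mapE swapE. Qed.

Lemma tensor_mapr_comp M N N' N'' (f : {linear N -> N'}) (g : {linear N' -> N''}) t :
  tensor_mapr M g (tensor_mapr M f t) = tensor_mapr M (hom_comp g f) t.
Proof. by rewrite !tensor_mapr_def swapK tensor_map_comp. Qed.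

Lemma tensor_mapr_can M N N' (f : {linear N -> N'}) (g : {linear N' -> N}) :
  cancel f g -> cancel (tensor_mapr M f) (tensor_mapr M g).
Proof.
move=> fK t; rewrite tensor_mapr_comp tensor_mapr_def -[RHS]swapK; congr (swap _ _ _).
by rewrite -[RHS]tensor_map_id; apply: tensor_map_ext.
Qed.

Lemma tensor_mapC A B N N' (f : {linear A -> B}) (g : {linear N -> N'}) t :
  tensor_map f N' (tensor_mapr A g t) = tensor_mapr B g (tensor_map f N t).
Proof.
apply: (@tensor_ext _ _ _ _ (hom_comp (tensor_map f N') (tensor_mapr A g))
  (hom_comp (tensor_mapr B g) (tensor_map f N))) => a n.
rewrite -[LHS]/(tensor_map f N' (tensor_mapr A g _)) tensor_maprE tensor_mapE.
by rewrite -[RHS]/(tensor_mapr B g (tensor_map f N _)) tensor_mapE tensor_maprE.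
Qed.

Lemma tensor_map_surj A B (f : {linear A -> B}) N :
  (forall b, exists a, f a = b) -> forall t, exists s, tensor_map f N s = t.
Proof.
move=> surj t; elim/tensor_ind: t => [b n|_ _ [s <-] [t <-]].
  by have [a <-] := surj b; exists (tens A N a n); rewrite tensor_mapE.
by exists (s + t); rewrite linearD.
Qed.

Lemma tensor_map_bij A B (f : {linear A -> B}) N : bijective f -> bijective (tensor_map f N).
Proof.
move=> /linear_inverse[g [fK gK]]; exists (tensor_map g N) => t.
  by rewrite tensor_map_comp -[RHS](tensor_map_id t); apply: tensor_map_ext.
by rewrite tensor_map_comp -[RHS](tensor_map_id t); apply: tensor_map_ext.
Qed.

(** The quotient of B (x) N by the image of A (x) N receives a map from P (x) N,
    because b |-> b (x) - vanishes in it on the kernel of g; so whatever dies in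
    P (x) N dies in that quotient. *)
Lemma tensor_right_exact A B P (f : {linear A -> B}) (g : {linear B -> P}) N :
    (forall p, exists b, g b = p) -> (forall b, g b = 0 -> exists a, f a = b) ->
  forall t, tensor_map g N t = 0 -> exists s, tensor_map f N s = t.
Proof.
move=> surj ex t gt0.
pose S := submod_im (tensor_map f N).
pose pi : {linear tensor B N -> quotmod S} := quotmod_pi S.
have pi0 s : pi s = 0 <-> s \in S.
  by rewrite -(linear0 pi) -[s in s \in S]subr0; exact: quotmod_piE.
have ker b : g b = 0 -> hom_comp (hom_post N pi) (tens B N) b = 0.
  move=> /ex[a <-]; apply: hom_ext => n; apply/pi0/submod_imP.
  by exists (tens A N a n); rewrite tensor_mapE.
have [h hg] := linear_factor surj ker.
have piE : pi t = tensor_lift h (tensor_map g N t).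
  apply: (@tensor_ext _ _ _ _ pi (hom_comp (tensor_lift h) (tensor_map g N))) => b n.
  by rewrite -[RHS]/(tensor_lift h (tensor_map g N _)) tensor_mapE tensor_liftE hg.
by apply/submod_imP/pi0; rewrite piE gt0 linear0.
Qed.

(** Flatness is injectivity preservation; factoring g through its image combines
    it with right exactness. *)
Lemma flat_exact A B P (f : {linear A -> B}) (g : {linear B -> P}) F :
    flat F -> (forall b, g b = 0 -> exists a, f a = b) ->
  forall t, tensor_map g F t = 0 -> exists s, tensor_map f F s = t.
Proof.
move=> flatF ex t gt0.
pose I := submod (submod_im g).
have gI b : g b \in submod_im g by apply/submod_imP; exists b.
have lin_g' : linear (fun b => Submod (gI b) : I).
  by move=> a x y; apply: val_inj; rewrite /= linearP.
pose g' : {linear B -> I} := linear_map lin_g'; pose incl := submod_incl (submod_im g).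
apply: (@tensor_right_exact _ _ _ f g') => [[p pI]|b /(congr1 val)|].
- by have /submod_imP[b bp] := pI; exists b; apply: val_inj.
- exact: ex.
have incl_inj : injective incl by exact: val_inj.
apply: (flatF _ _ incl incl_inj); rewrite linear0 tensor_map_comp -[RHS]gt0.
exact: tensor_map_ext.
Qed.

End Tensor.

(** * Chain complexes, balancing and flat modules *)

Section Complexes.
Variable R : comPzRingType.
Implicit Types (K L X Y : chain_complex R) (M N : lmodType R).

Lemma exact_complexP X :
  exact_complex X <-> (forall y, exists x, bd X 0 x = y) /\
    (forall n y, bd X n y = 0 -> exists x, bd X n.+1 x = y).
Proof.
split=> [ex | [surj ex] [|n]]; last 2 first.
- by apply/subquotient_zeroP => y _; apply/submod_imP/surj.
- by apply/subquotient_zeroP => y /submod_kerP y0; apply/submod_imP/ex.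
split=> [y | n y y0]; apply/submod_imP.
  by have /subquotient_zeroP := ex 0%N; apply; apply/submod_kerP.
by have /subquotient_zeroP := ex n.+1; apply; apply/submod_kerP.
Qed.

Section ComplexIso.
Variables (X Y : chain_complex R) (phi : forall n, {linear X n -> Y n}).
Hypothesis phi_bij : forall n, bijective (phi n).
Hypothesis phi_bd : forall n x, phi n (bd X n x) = bd Y n (phi n.+1 x).

Lemma homology_iso n : module_iso (homology X n) (homology Y n).
Proof.
apply: (@subquotient_iso _ _ _ _ _ _ _ (fun x y => phi n x = y)).
- by move=> a x y x' y' <- <-; rewrite linearP.
- move=> x Zx; exists (phi n x) => //; case: n x Zx => [|n] x Zx; apply/submod_kerP => //.
  by rewrite -phi_bd (elimT (submod_kerP _ _) Zx) linear0.
- have [psi _ psiK] := phi_bij n; move=> y Zy; exists (psi y) => //.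
  case: n y Zy psi psiK => [|n] y Zy psi psiK; apply/submod_kerP => //.
  by apply: (linear_bijective_ker (phi_bij n)); rewrite phi_bd psiK; exact/submod_kerP.
move=> x y _ _ <-; split=> /submod_imP[z zE]; apply/submod_imP.
  by exists (phi n.+1 z); rewrite -phi_bd zE.
have [psi _ psiK] := phi_bij n.+1; exists (psi z).
by apply: (bij_inj (phi_bij n)); rewrite phi_bd psiK.
Qed.

Lemma exact_complex_iso : exact_complex X -> exact_complex Y.
Proof. by move=> ex n; apply: module_iso_zero (homology_iso n) (ex n). Qed.
End ComplexIso.

Definition truncation X : chain_complex R :=
  @ChainComplex R (fun n => X n.+1) (fun n => bd X n.+1) (fun n => @bd_bd R X n.+1).

(** The balancing principle behind all comparisons below, for the double complex
    K p (x) L q. The complexes K and L include their augmentation targets K 0 and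
    L 0 in degree 0. *)
Lemma balance K L :
    (forall p, exact_complex (complex_tensor L (K p.+1))) ->
    (forall q, exact_complex (complex_tensor K (L q.+1))) ->
  forall n, module_iso (homology (complex_tensor (truncation K) (L 0)) n)
                       (homology (complex_tensor (truncation L) (K 0)) n).
Proof.
move=> exL exK n.
have dv_dv p q x : tensor_mapr (K p) (bd L q) (tensor_mapr (K p) (bd L q.+1) x) = 0.
  by rewrite !tensor_mapr_def swapK (@tensor_map_bd_bd _ L) linear0.
have dh_dv p q x : tensor_map (bd K p) (L q) (tensor_mapr (K p.+1) (bd L q) x) =
    tensor_mapr (K p) (bd L q) (tensor_map (bd K p) (L q.+1) x) by exact: tensor_mapC.
have dv_surj p y : exists x, tensor_mapr (K p.+1) (bd L 0) x = y.
  have [/(_ (swap _ _ y))[x xE] _] := (exact_complexP _).1 (exL p).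
  by exists (swap _ _ x); rewrite tensor_mapr_def swapK [tensor_map _ _ _]xE swapK.
have dv_exact p q y : tensor_mapr (K p.+1) (bd L q) y = 0 ->
    exists x, tensor_mapr (K p.+1) (bd L q.+1) x = y.
  move=> y0; have [_ /(_ q (swap _ _ y))[|x xE]] := (exact_complexP _).1 (exL p).
    by apply: (can_inj (@swapK _ _ _)); rewrite linear0; exact: y0.
  by exists (swap _ _ x); rewrite tensor_mapr_def swapK [tensor_map _ _ _]xE swapK.
have dh_surj q y : exists x, tensor_map (bd K 0) (L q.+1) x = y.
  by have [/(_ y) h _] := (exact_complexP _).1 (exK q).
have dh_exact p q y : tensor_map (bd K p) (L q.+1) y = 0 ->
    exists x, tensor_map (bd K p.+1) (L q.+1) x = y.
  by have [_ /(_ p y) h] := (exact_complexP _).1 (exK q).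
apply: module_iso_trans (double_complex_iso (fun p q => @tensor_map_bd_bd _ K (L q) p)
  dv_dv dh_dv dv_surj dv_exact dh_surj dh_exact n) _.
apply: (@homology_iso (left_column dv_dv) (complex_tensor (truncation L) (K 0))
  (fun q => swap (K 0) (L q.+1))) => [q|q x]; last by rewrite /= swapK.
by exists (swap _ _); exact: swapK.
Qed.

Lemma exact_complex_flat K F : flat F -> exact_complex K -> exact_complex (complex_tensor K F).
Proof.
move=> flatF /exact_complexP[surj ex]; apply/exact_complexP; split.
  exact: tensor_map_surj.
by move=> n; apply: flat_exact => // y; apply: ex.
Qed.

(** In the lowest two degrees right exactness suffices. *)
Lemma exact_complex_tensor K N : exact_complex K ->
    (forall n, (1 <= n)%N -> module_zero (homology (complex_tensor (truncation K) N) n)) ->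
  exact_complex (complex_tensor K N).
Proof.
move=> /exact_complexP[surj ex] acyclic; apply/exact_complexP; split.
  exact: tensor_map_surj.
case=> [|n] y y0; first by apply: tensor_right_exact y0 => //; exact: ex.
have /subquotient_zeroP := acyclic n.+1 isT => /(_ y (introT (submod_kerP _ _) y0)).
by move=> /submod_imP.
Qed.

Lemma free_resolution_aug M x : free_cover M (free_resolution_bd M 0 x) = 0.
Proof. by apply/submod_kerP; exact: valP. Qed.

Definition augmented_free_resolution M : augmented_complex M :=
  @AugmentedComplex R M (free_resolution M) (free_cover M) (@free_resolution_aug M).

Definition free_resolution_plus M : chain_complex R := plus_complex (augmented_free_resolution M).

Lemma free_cover_surj M y : exists x, free_cover M x = y.
Proof. by exists (free_gen R y); exact: free_liftE. Qed.

Lemma free_resolution_exact M : exact_complex (free_resolution_plus M).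
Proof.
apply/exact_complexP; split=> [|n y y0]; first exact: free_cover_surj.
have {}y0 : free_cover (nth_syzygy M n) y = 0.
  by case: n y y0 => [|n] y y0 //; apply: val_inj; exact: y0.
have [x xE] := free_cover_surj (Submod (introT (submod_kerP _ _) y0) : nth_syzygy M n.+1).
by exists x; rewrite [LHS]/= xE.
Qed.

End Complexes.

Section Flat.
Variable R : comPzRingType.
Implicit Types M N A B F : lmodType R.

Lemma flat_iso F F' : module_iso F F' -> flat F -> flat F'.
Proof.
move=> [u /linear_inverse[v [uK vK]]] flatF A B f inj_f; apply: raddf_inj => t t0.
rewrite -[t](tensor_mapr_can (M := A) vK) -[RHS](linear0 (tensor_mapr A u)); congr (tensor_mapr _ _ _).
by apply: (flatF _ _ _ inj_f); rewrite tensor_mapC t0 !linear0.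
Qed.

Section FlatFree.
Variable X : choiceType.

Definition tensor_coef_fun M (x : X) (m : M) (u : free R X) : M := free_coef u x *: m.

Lemma tensor_coef_linr M x m : linear (@tensor_coef_fun M x m).
Proof. by move=> a u v; rewrite /tensor_coef_fun scalerA -scalerDl. Qed.

Lemma tensor_coef_linl M x u : linear ((@tensor_coef_fun M x)^~ u).
Proof. by move=> a m n; rewrite /tensor_coef_fun scalerDr !scalerA mulrC. Qed.

Definition tensor_coef M x : {linear tensor M (free R X) -> M} :=
  tensor_lift (bilinear_map (tensor_coef_linr (M := M) x) (tensor_coef_linl (M := M) x)).

Lemma tensor_coefE M x m u : tensor_coef M x (tens M _ m u) = free_coef u x *: m.
Proof. exact: tensor_liftE. Qed.

Lemma tensor_coef_map A B (f : {linear A -> B}) x t :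
  tensor_coef B x (tensor_map f _ t) = f (tensor_coef A x t).
Proof.
apply: (@tensor_ext _ _ _ _ (hom_comp (tensor_coef B x) (tensor_map f _))
  (hom_comp f (tensor_coef A x))) => a u.
rewrite -[LHS]/(tensor_coef B x (tensor_map f _ (tens _ _ a u))) tensor_mapE.
by rewrite -[RHS]/(f (tensor_coef A x (tens _ _ a u))) !tensor_coefE linearZ_LR.
Qed.

(** Any duplicate-free list that contains the support will do; this freedom lets two
    elements be expanded over one common list. *)
Lemma free_sum (u : free R X) (s : seq X) : uniq s ->
  (forall x, free_coef u x != 0 -> x \in s) -> u = \sum_(x <- s) free_coef u x *: free_gen R x.
Proof.
move=> uniq_s us; apply: val_inj; apply/funext => y.
rewrite (raddf_sum (submod_incl (finsupp R X))) fct_sumE.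
rewrite (eq_bigr (fun x => free_coef u x * (y == x)%:R)) //.
have [ys|ys] := boolP (y \in s).
  rewrite (bigD1_seq y) //= eqxx mulr1 big1 ?addr0 // => x.
  by rewrite eq_sym => /negPf ->; rewrite mulr0.
rewrite big_seq big1 => [|x xs]; first by apply/eqP; apply: contraNT ys => /us.
by have [yx|_] := eqVneq y x; [rewrite yx xs in ys | rewrite mulr0].
Qed.

Lemma tensor_free_sum M (t : tensor M (free R X)) : exists s : seq X,
  forall s', uniq s' -> {subset s <= s'} ->
  t = \sum_(x <- s') tens M _ (tensor_coef M x t) (free_gen R x).
Proof.
elim/tensor_ind: t => [m u|t t' [s ts] [s' ts']].
  have /finite_seqP[s sE] : finite_set [set x | free_coef u x != 0]%classic by exact/asboolP/(valP u).
  exists s => s' uniq_s' ss'; have uE : u = \sum_(x <- s') free_coef u x *: free_gen R x.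
    by apply: free_sum => // x xu; apply: ss'; have : [set` s]%classic x by rewrite -sE.
  rewrite [in LHS]uE linear_sum; apply: eq_bigr => x _.
  by rewrite tensor_coefE !linearZ_LR.
exists (s ++ s') => r uniq_r sub; rewrite [in LHS](ts r) //; last first.
  by move=> x xs; apply: sub; rewrite mem_cat xs.
rewrite [X in _ + X = _](ts' r) //; last by move=> x xs; apply: sub; rewrite mem_cat xs orbT.
by rewrite -big_split; apply: eq_bigr => x _; rewrite !linearD.
Qed.

(** An element of A (x) R^(X) is determined by its coordinates in A, and taking
    coordinates commutes with f. *)
Lemma flat_free : flat (free R X).
Proof.
move=> A B f inj_f; apply: raddf_inj => t t0.
have [s ts] := tensor_free_sum t; rewrite (ts (undup s)) ?undup_uniq //; last first.
  by move=> x; rewrite mem_undup.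
rewrite big1 // => x _; suff -> : tensor_coef A x t = 0 by rewrite linear0.
by apply: inj_f; rewrite -tensor_coef_map t0 !linear0.
Qed.
End FlatFree.

Lemma free_unit_iso : module_iso (free R unit) (R^o : lmodType R).
Proof.
have lin : linear (fun u : free R unit => free_coef u tt : R^o) by [].
exists (linear_map lin); apply: linear_bijective => [u u0|r].
  by apply: val_inj; apply/funext => -[].
by exists (r *: free_gen R tt); rewrite -[LHS]/(r * (tt == tt)%:R) eqxx mulr1.
Qed.

Lemma flat_regular : flat (R^o : lmodType R).
Proof. exact: flat_iso free_unit_iso (@flat_free unit). Qed.

Lemma free_resolution_plus_flat M n : flat (free_resolution_plus M n.+1).
Proof. exact: flat_free. Qed.

End Flat.

(** * Associativity of the tensor product *)

Section Associativity.
Variable R : comPzRingType.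
Implicit Types (L M N P C F W : lmodType R) (K : chain_complex R).

Lemma tensor_lift_linear_arg M N P : linear (@tensor_lift R M N P).
Proof.
move=> a b b'; apply/hom_ext/tensor_ext => m n.
rewrite tensor_liftE -[RHS]/(a *: tensor_lift b (tens M N m n) + tensor_lift b' (tens M N m n)).
by rewrite !tensor_liftE.
Qed.

Section RegularTensor.
Variable M : lmodType R.

Lemma scale_linl (m : M) : linear (fun r : R^o => r *: m).
Proof. by move=> a r s; rewrite scalerDl -scalerA. Qed.

Lemma scale_linr (r : R^o) : linear (fun m : M => r *: m).
Proof. by move=> a m n; rewrite scalerDr !scalerA mulrC. Qed.

Definition tensor_scale : {linear tensor R^o M -> M} :=
  tensor_lift (bilinear_map scale_linr scale_linl).

Lemma tensor_scaleE r m : tensor_scale (tens R^o M r m) = r *: m.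
Proof. exact: tensor_liftE. Qed.

Lemma tensor_scaleK t : tens R^o M 1 (tensor_scale t) = t.
Proof.
apply: (tensor_ext (f := hom_comp (tens R^o M 1) tensor_scale) (g := idfun)) => r m.
rewrite -[LHS]/(tens R^o M 1 (tensor_scale _)) tensor_scaleE linearZ_LR.
by rewrite -[RHS]/(tens R^o M r m) -[r in RHS]mulr1 [in RHS](linearZ_LR (tens R^o M) r 1).
Qed.

Lemma tensor_scale_bij : bijective tensor_scale.
Proof.
by exists (tens R^o M 1) => [|m]; [exact: tensor_scaleK | rewrite tensor_scaleE scale1r].
Qed.
End RegularTensor.

Section TrilinearMap.
Variables (L M N W : lmodType R) (k : L -> M -> N -> W).
Hypotheses (lin1 : forall m n, linear (fun l => k l m n))
  (lin2 : forall l n, linear (fun m => k l m n)) (lin3 : forall l m, linear (k l m)).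

Lemma trilinear_map_subproof : linear (fun l => bilinear_map (lin3 l) (lin2 l)).
Proof. by move=> a l l'; apply: hom_ext => m; apply: hom_ext => n; exact: lin1. Qed.

(** A trilinear map curried with its first argument apart. *)
Definition trilinear_map : {linear L -> {linear tensor M N -> W}} :=
  hom_comp (linear_map (@tensor_lift_linear_arg M N W)) (linear_map trilinear_map_subproof).

Lemma trilinear_mapE l m n : trilinear_map l (tens M N m n) = k l m n.
Proof. exact: tensor_liftE. Qed.
End TrilinearMap.

Lemma tensor_extl L M N W (f g : {linear tensor (tensor L M) N -> W}) :
    (forall l m n, f (tens _ _ (tens _ _ l m) n) = g (tens _ _ (tens _ _ l m) n)) -> f =1 g.
Proof.
move=> fg; apply: tensor_ext => t n.
exact: (tensor_ext (f := hom_comp f (flip (tens _ _) n)) (g := hom_comp g (flip (tens _ _) n))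
  (fun l m => fg l m n) t).
Qed.

Lemma tensor_extr L M N W (f g : {linear tensor L (tensor M N) -> W}) :
    (forall l m n, f (tens _ _ l (tens _ _ m n)) = g (tens _ _ l (tens _ _ m n))) -> f =1 g.
Proof.
move=> fg; apply: tensor_ext => l t.
exact: (tensor_ext (f := hom_comp f (tens _ _ l)) (g := hom_comp g (tens _ _ l)) (fg l) t).
Qed.

Section Assoc.
Variables (P C F : lmodType R).

Definition assoc_fun (f : F) (p : P) (c : C) := tens P _ p (tens F C f c).
Lemma assoc_fun1 p c : linear (fun f => assoc_fun f p c).
Proof. by move=> a x y; rewrite /assoc_fun !linearP. Qed.
Lemma assoc_fun2 f c : linear (fun p => assoc_fun f p c).
Proof. by move=> a x y; rewrite /assoc_fun !linearP. Qed.
Lemma assoc_fun3 f p : linear (assoc_fun f p).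
Proof. by move=> a x y; rewrite /assoc_fun !linearP. Qed.

Definition assoc : {linear tensor (tensor P C) F -> tensor P (tensor F C)} :=
  tensor_lift (flip (trilinear_map assoc_fun1 assoc_fun2 assoc_fun3)).

Lemma assocE p c f : assoc (tens _ _ (tens _ _ p c) f) = tens _ _ p (tens _ _ f c).
Proof. by rewrite tensor_liftE [LHS]trilinear_mapE. Qed.

Definition assoc_inv_fun (p : P) (f : F) (c : C) := tens _ F (tens P C p c) f.
Lemma assoc_inv_fun1 f c : linear (fun p => assoc_inv_fun p f c).
Proof. by move=> a x y; rewrite /assoc_inv_fun !linearP. Qed.
Lemma assoc_inv_fun2 p c : linear (fun f => assoc_inv_fun p f c).
Proof. by move=> a x y; rewrite /assoc_inv_fun !linearP. Qed.
Lemma assoc_inv_fun3 p f : linear (assoc_inv_fun p f).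
Proof. by move=> a x y; rewrite /assoc_inv_fun !linearP. Qed.

Definition assoc_inv : {linear tensor P (tensor F C) -> tensor (tensor P C) F} :=
  tensor_lift (trilinear_map assoc_inv_fun1 assoc_inv_fun2 assoc_inv_fun3).

Lemma assoc_invE p c f : assoc_inv (tens _ _ p (tens _ _ f c)) = tens _ _ (tens _ _ p c) f.
Proof. by rewrite tensor_liftE trilinear_mapE. Qed.

Lemma assoc_bij : bijective assoc.
Proof.
exists assoc_inv => t.
  apply: (tensor_extl (f := hom_comp assoc_inv assoc) (g := idfun)) => p c f.
  by rewrite -[LHS]/(assoc_inv (assoc _)) assocE assoc_invE.
apply: (tensor_extr (f := hom_comp assoc assoc_inv) (g := idfun)) => p f c.
by rewrite -[LHS]/(assoc (assoc_inv _)) assoc_invE assocE.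
Qed.
End Assoc.

Lemma assoc_natural P P' C F (g : {linear P -> P'}) t :
  assoc P' C F (tensor_map (tensor_map g C) F t) = tensor_map g _ (assoc P C F t).
Proof.
apply: (tensor_extl (f := hom_comp (assoc P' C F) (tensor_map (tensor_map g C) F))
  (g := hom_comp (tensor_map g _) (assoc P C F))) => p c f.
rewrite -[LHS]/(assoc _ _ _ (tensor_map (tensor_map g C) F _)) !tensor_mapE assocE.
by rewrite -[RHS]/(tensor_map g _ (assoc _ _ _ _)) assocE tensor_mapE.
Qed.

(** K (x) (F (x) C) is (K (x) C) (x) F. *)
Lemma exact_complex_flat_C C K X :
  exact_complex (complex_tensor K C) -> flat_C C X -> exact_complex (complex_tensor K X).
Proof.
move=> exKC [F [flatF [e bij_e]]].
have [e' [eK e'K]] := linear_inverse bij_e.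
pose phi n : {linear tensor (tensor (K n) C) F -> tensor (K n) X} :=
  hom_comp (tensor_mapr (K n) e) (assoc (K n) C F).
have bij_phi n : bijective (phi n).
  apply: bij_comp (assoc_bij _ _ _).
  by exists (tensor_mapr (K n) e'); apply: tensor_mapr_can.
have phi_bd n x : phi n (tensor_map (tensor_map (bd K n) C) F x) =
    tensor_map (bd K n) X (phi n.+1 x).
  have phiE m y : phi m y = tensor_mapr (K m) e (assoc (K m) C F y) by [].
  by rewrite !phiE assoc_natural tensor_mapC.
exact: (exact_complex_iso (X := complex_tensor (complex_tensor K C) F) (Y := complex_tensor K X)
  bij_phi phi_bd (exact_complex_flat flatF exKC)).
Qed.

End Associativity.

(** * Finitely generated submodules and finite families *)

Section Span.
Variables (R : comPzRingType) (V : lmodType R).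
Implicit Types s : seq V.

Lemma mem_span s a : a \in s -> a \in submod_span [set` s].
Proof. by move=> sa; apply/asboolP => S; apply. Qed.

Lemma span_subset s (S : submodClosed V) : (forall a, a \in s -> a \in S) ->
  forall x, x \in submod_span [set` s] -> x \in S.
Proof. by move=> sS x /asboolP; apply=> a; apply: sS. Qed.

Lemma submodB (S : submodClosed V) x y : x \in S -> y \in S -> x - y \in S.
Proof. by move=> Sx Sy; rewrite -scaleN1r rpredD ?rpredZ. Qed.

Definition combination n (c : 'I_n -> V) (r : 'rV[R]_n) : V := \sum_i r 0 i *: c i.

Lemma combination_linear n (c : 'I_n -> V) : linear (combination c).
Proof.
move=> a r s; rewrite /combination scaler_sumr -big_split; apply: eq_bigr => i _.
by rewrite !mxE /= scalerDl scalerA.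
Qed.

Definition combine n (c : 'I_n -> V) : {linear 'rV[R]_n -> V} :=
  linear_map (combination_linear c).

Lemma combine_linear_family n (r : 'rV[R]_n) : linear (fun c : 'I_n -> V => combine c r).
Proof.
move=> a c c'; rewrite /= /combination scaler_sumr -big_split; apply: eq_bigr => i _.
by rewrite /= -[(a *: c + c') i]/(a *: c i + c' i) scalerDr !scalerA mulrC.
Qed.

Lemma combine_delta n (c : 'I_n -> V) i : combine c (delta_mx 0 i) = c i.
Proof.
rewrite /= /combination (bigD1 i) //= mxE !eqxx scale1r big1 ?addr0 // => k ki.
by rewrite mxE (negPf ki) andbF scale0r.
Qed.

End Span.

Lemma combine_morph (R : comPzRingType) (V W : lmodType R) n (f : {linear V -> W})
    (c : 'I_n -> V) r : f (combine c r) = combine (f \o c) r.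
Proof. by rewrite /= /combination linear_sum; apply: eq_bigr => i _; rewrite linearZ_LR. Qed.

Section Noetherian.
Variable R : comPzRingType.
Hypothesis noethR : noetherian R.

Lemma first_coord_linear n : linear (fun x : 'rV[R]_(1 + n) => x 0 (lshift n 0) : R^o).
Proof. by move=> a x y; rewrite !mxE. Qed.

Lemma row_mx0_linear n : linear (fun y : 'rV[R]_n => row_mx (0 : 'rV[R]_1) y).
Proof. by move=> a x y; rewrite scale_row_mx add_row_mx scaler0 addr0. Qed.

(** Induction on n: lifts of generators of the ideal of first coordinates, together
    with generators of the vectors of S with first coordinate 0, generate S. *)
Lemma noetherian_row n (S : submodClosed 'rV[R]_n) :
  exists s : seq 'rV[R]_n, S =i submod_span [set` s].
Proof.
elim: n S => [|n IHn] S.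
  by exists [::] => x; rewrite [x]thinmx0 !rpred0.
pose p := linear_map (@first_coord_linear n).
pose iota := linear_map (@row_mx0_linear n).
have [s sI] := noethR (submod_im (hom_comp p (submod_incl S))).
have [s' s'S] := IHn (submod_preim iota S).
have lift a : exists x : 'rV[R]_(1 + n), a \in s -> x \in S /\ p x = a.
  have [sa|] := boolP (a \in s); last by exists 0.
  have /submod_imP[x xa] : a \in submod_im (hom_comp p (submod_incl S)).
    by rewrite sI mem_span.
  by exists (val x) => _; split; [exact: valP | exact: xa].
have [g gP] := choice lift.
pose T : seq 'rV[R]_(1 + n) := map g s ++ map iota s'.
have TS z : z \in submod_span [set` T] -> z \in S.
  apply: span_subset => a; rewrite mem_cat => /orP[] /mapP[b bs ->]; first by have [] := gP _ bs.
  have : b \in submod_preim iota S by rewrite s'S mem_span.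
  by [].
exists T => x; apply/idP/idP => [Sx|]; last exact: TS.
have /submod_imP[[y Ty] /= yx] : p x \in submod_im (hom_comp p (submod_incl (submod_span [set` T]))).
  apply: (span_subset (s := s)) => [a sa|].
    have Ta : g a \in submod_span [set` T] by rewrite mem_span // mem_cat map_f.
    by apply/submod_imP; exists (Submod Ta); have [_] := gP _ sa.
  by rewrite -sI; apply/submod_imP; exists (Submod Sx).
have xyE : x - y = iota (rsubmx (x - y : 'rV[R]_(1 + n))).
  rewrite -[LHS](@hsubmxK _ 1 1 n) [lsubmx _](_ : _ = 0) //.
  by apply/rowP => k; rewrite ord1 !mxE -yx subrr.
have : rsubmx (x - y : 'rV[R]_(1 + n)) \in submod_preim iota (submod_span [set` T]).
  apply: (span_subset (s := s')) => [a sa|].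
    have : iota a \in submod_span [set` T].
      by apply: mem_span; rewrite mem_cat [X in _ || X]map_f ?orbT.
    by [].
  have : iota (rsubmx (x - y : 'rV[R]_(1 + n))) \in S by rewrite -xyE; apply: submodB Sx (TS _ Ty).
  by rewrite -s'S.
rewrite -[_ \in submod_preim _ _]/(iota _ \in submod_span [set` T]) -xyE => Txy.
by rewrite -[x](subrK y) rpredD.
Qed.
End Noetherian.

Section FiniteFamilies.
Variables (R : comPzRingType) (I : finType) (V N : lmodType R).

Lemma fct_proj_linear (i : I) : linear (fun x : I -> V => x i).
Proof. by []. Qed.
Definition fct_proj i : {linear (I -> V) -> V} := linear_map (fct_proj_linear i).

Lemma fct_inj_linear (i : I) : linear (fun (v : V) (k : I) => if k == i then v else 0).
Proof.
move=> a x y; apply/funext => k.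
rewrite -[RHS]/(a *: (if k == i then x else 0) + (if k == i then y else 0)).
by case: eqP => _ //; rewrite scaler0 addr0.
Qed.
Definition fct_inj i : {linear V -> (I -> V)} := linear_map (fct_inj_linear i).

Lemma fct_decomp (x : I -> V) : x = \sum_i fct_inj i (x i).
Proof.
apply/funext => k; rewrite fct_sumE (bigD1 k) //= eqxx big1 ?addr0 // => i.
by rewrite eq_sym => /negPf ->.
Qed.

Lemma tensor_fct_decomp (t : tensor (I -> V) N) :
  t = \sum_i tensor_map (fct_inj i) N (tensor_map (fct_proj i) N t).
Proof.
elim/tensor_ind: t => [x n|t t' {1}-> {1}->].
  rewrite -[LHS]/(flip (tens _ _) n x) {1}[x]fct_decomp linear_sum; apply: eq_bigr => i _.
  by rewrite !tensor_mapE.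
by rewrite -big_split; apply: eq_bigr => i _; rewrite !linearD.
Qed.

Lemma tensor_fct_ext (t t' : tensor (I -> V) N) :
  (forall i, tensor_map (fct_proj i) N t = tensor_map (fct_proj i) N t') -> t = t'.
Proof.
move=> tt'; rewrite [t]tensor_fct_decomp [t']tensor_fct_decomp.
by apply: eq_bigr => i _; rewrite tt'.
Qed.

Lemma tensor_fct_sum (y : I -> tensor V N) i :
  tensor_map (fct_proj i) N (\sum_k tensor_map (fct_inj k) N (y k)) = y i.
Proof.
rewrite linear_sum (bigD1 i) //= big1 ?addr0 => [|k ki].
  rewrite tensor_map_comp -[RHS]tensor_map_id; apply: tensor_map_ext => v.
  by rewrite /= eqxx.
rewrite tensor_map_comp; apply: (tensor_ext (g := \0)) => v n.
by rewrite tensor_mapE [hom_comp _ _ _](_ : _ = 0) ?linear0 //= eq_sym (negPf ki).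
Qed.
End FiniteFamilies.

Definition combine_family (R : comPzRingType) (V : lmodType R) n (r : 'rV[R]_n) :
  {linear ('I_n -> V) -> V} := linear_map (@combine_linear_family R V n r).

Lemma tensor_combine_family (R : comPzRingType) (V N : lmodType R) n (r : 'rV[R]_n) t :
  tensor_map (combine_family V r) N t =
  combine (fun i => tensor_map (@fct_proj R _ V i) N t) r.
Proof.
elim/tensor_ind: t => [x m|s t sE tE].
  rewrite tensor_mapE -[LHS]/(flip (tens V N) m (combine x r)) combine_morph.
  by congr (\sum_i _); apply/funext=> i; rewrite tensor_mapE.
rewrite linearD sE tE /= /combination -big_split; apply: eq_bigr => i _.
by rewrite linearD scalerDr.
Qed.

(** * Flat modules and the Auslander map *)

Section FlatAuslander.
Variables (R : comPzRingType) (C : lmodType R).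
Hypotheses (noethR : noetherian R) (fgC : finitely_generated C).

Lemma finite_presentation : exists n (c : 'I_n -> C) (rel : seq 'rV[R]_n),
  (forall x, exists r, combine c r = x) /\ submod_ker (combine c) =i submod_span [set` rel].
Proof.
have [s sC] := fgC.
have [rel relE] := noetherian_row noethR (submod_ker (combine (fun i : 'I_(size s) => s`_i))).
exists (size s), (fun i => s`_i), rel; split=> // x; apply/submod_imP.
apply: (span_subset (s := s)) (sC x) => a sa; apply/submod_imP.
exists (delta_mx 0 (Ordinal (etrans (index_mem a s) sa))).
by rewrite combine_delta nth_index.
Qed.

Hypothesis homC : bijective (homothety C).
Variable F : lmodType R.
Hypothesis flatF : flat F.

(** Flat modules satisfy the isomorphism condition of the Auslander class. With C
    generated by c_0, ..., c_(n-1) subject to finitely many relations, an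
    endomorphism of C is a family in C^n satisfying the relations, so that
    bijectivity of the homothety map says that 0 -> R -> C^n -> C^m is exact.
    Tensoring with F keeps it exact and makes F the kernel of
    (C (x) F)^n -> (C (x) F)^m, which is Hom(C, C (x) F). *)
Lemma flat_auslander_map_bij : bijective (auslander_map C F).
Proof.
have [n [c [rel [surj relE]]]] := finite_presentation.
have gen_ext (W : lmodType R) (f g : {linear C -> W}) : (forall i, f (c i) = g (c i)) -> f = g.
  move=> fg; apply: hom_ext => x; have [r <-] := surj x.
  by rewrite !combine_morph; have -> : f \o c = g \o c by apply/funext => i; exact: fg.
have lin_j : linear (fun r : R^o => (fun i => r *: c i) : 'I_n -> C).
  by move=> a r s; apply/funext => i; rewrite scalerDl -scalerA.
(* j r is the family (r c_i), and d below evaluates the relations on a family. *)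
pose j := linear_map lin_j.
pose row l := tnth (in_tuple rel) l.
have lin_d : linear (fun x : 'I_n -> C => (fun l => combine x (row l)) : 'I_(size rel) -> C).
  by move=> a x y; apply/funext => l; rewrite combine_linear_family.
pose d := linear_map lin_d.
have j_inj : injective j.
  apply: raddf_inj => r jr0; apply: (bij_inj homC); apply: gen_ext => i.
  by rewrite !homothetyE scale0r -[LHS]/(j r i) jr0.
have ex_j x : d x = 0 -> exists r, j r = x.
  move=> dx0.
  have ker r : combine c r = 0 -> combine x r = 0.
    move=> /submod_kerP; rewrite relE => rr; apply/submod_kerP; move: r rr.
    apply: span_subset => r /(tnthP (in_tuple rel))[l ->]; apply/submod_kerP.
    by rewrite -[LHS]/(d x l) dx0.
  (* The family x satisfies the relations, hence defines an endomorphism of C. *)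
  have [phi phiE] := linear_factor surj ker.
  have [h _ hK] := homC; exists (h phi); apply/funext => i.
  rewrite /j linear_mapE -(homothetyE (h phi) (c i)) hK.
  by rewrite -(combine_delta c i) phiE combine_delta.
have jE f i :
    tensor_map (fct_proj C i) F (tensor_map j F (tens _ F (1 : R^o) f)) = tens C F (c i) f.
  by rewrite !tensor_mapE [fct_proj _ _ _]scale1r.
apply: linear_bijective => [f f0 | phi].
  rewrite -[f]scale1r -(tensor_scaleE (1 : R^o)) (_ : tens _ _ _ _ = 0) ?linear0 //.
  apply: (flatF j_inj); rewrite linear0; apply: tensor_fct_ext => i.
  by rewrite jE -auslander_mapE f0 linear0.
(* The values of phi on the generators, as one element of C^n (x) F. *)
pose t := \sum_i tensor_map (fct_inj C i) F (phi (c i)).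
have ti i : tensor_map (fct_proj C i) F t = phi (c i) by exact: tensor_fct_sum.
have [s sE] : exists s, tensor_map j F s = t.
  apply: (flat_exact flatF ex_j); apply: tensor_fct_ext => l; rewrite linear0.
  rewrite tensor_map_comp (tensor_map_ext (g := combine_family C (row l))) //.
  rewrite tensor_combine_family (_ : (fun i => _) = phi \o c); last exact/funext.
  rewrite -combine_morph (_ : combine c (row l) = 0) ?linear0 //.
  by apply/submod_kerP; rewrite relE mem_span // mem_tnth.
exists (tensor_scale F s); apply: gen_ext => i.
by rewrite auslander_mapE -jE tensor_scaleK sE ti.
Qed.
End FlatAuslander.

(** * Relative and absolute Tor *)

Section RelativeTor.
Variable R : comPzRingType.
Implicit Types C M N X Y : lmodType R.

Lemma Tor_balance M (K : chain_complex R) n :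
    exact_complex K ->
    (forall q, exact_complex (complex_tensor (free_resolution_plus M) (K q.+1))) ->
  module_iso (Tor n M (K 0)) (homology (complex_tensor (truncation K) M) n).
Proof.
move=> exK flatK; apply: (@balance _ (free_resolution_plus M) K) => // p.
exact: exact_complex_flat (@free_resolution_plus_flat _ _ _) exK.
Qed.

Lemma Tor_sym M N n : module_iso (Tor n M N) (Tor n N M).
Proof.
refine (Tor_balance n (@free_resolution_exact _ N) (fun q => _)).
exact: exact_complex_flat (@free_resolution_plus_flat _ _ _) (@free_resolution_exact _ M).
Qed.

(** Although Tor n C N is computed from the resolution of C, its vanishing makes
    the resolution of N stay exact after tensoring with C. *)
Lemma exact_complex_acyclic C N : (forall n, (1 <= n)%N -> module_zero (Tor n C N)) ->
  exact_complex (complex_tensor (free_resolution_plus N) C).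
Proof.
move=> acyclic; apply: exact_complex_tensor (@free_resolution_exact _ N) _ => n n1.
exact: module_iso_zero (Tor_sym C N n) (acyclic n n1).
Qed.

Lemma flat_C_self C : flat_C C C.
Proof.
exists R^o; split; first exact: flat_regular.
by exists (tensor_scale C); exact: tensor_scale_bij.
Qed.

Section Evaluation.
Variable C : lmodType R.

Definition eval_map X : {linear tensor {linear C -> X} C -> X} :=
  hom_comp (bass_map C X) (swap _ C).

Lemma eval_mapE X (f : {linear C -> X}) c : eval_map X (tens _ C f c) = f c.
Proof. by rewrite -[LHS]/(bass_map C X (swap _ C _)) swapE bass_mapE. Qed.

Lemma eval_map_natural X Y (g : {linear X -> Y}) t :
  eval_map Y (tensor_map (hom_post C g) C t) = g (eval_map X t).
Proof.
apply: (tensor_ext (f := hom_comp (eval_map Y) (tensor_map (hom_post C g) C))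
  (g := hom_comp g (eval_map X))) => f c.
rewrite -[LHS]/(eval_map Y (tensor_map _ C _)) tensor_mapE eval_mapE.
by rewrite -[RHS]/(g (eval_map X _)) eval_mapE.
Qed.

(** Through X = F (x) C the module Hom(C, X) is F itself, and evaluation becomes
    the identity of F (x) C. *)
Lemma flat_C_hom X : noetherian R -> semidualizing C -> flat_C C X ->
  flat {linear C -> X} /\ bijective (eval_map X).
Proof.
move=> noethR [fgC homC _] [F [flatF [e bij_e]]].
have bij_es : bijective (hom_comp e (swap C F)).
  by apply: bij_comp bij_e _; exists (swap F C); exact: swapK.
pose u : {linear F -> {linear C -> X}} :=
  hom_comp (hom_post C (hom_comp e (swap C F))) (auslander_map C F).
have bij_u : bijective u.
  apply: bij_comp (flat_auslander_map_bij noethR fgC homC flatF).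
  have [g [gK Kg]] := linear_inverse bij_es.
  by exists (hom_post C g) => h; apply: hom_ext => c; [exact: gK | exact: Kg].
split; first by apply: flat_iso flatF; exists u.
have [v uv vu] := tensor_map_bij C bij_u.
have evu t : eval_map X (tensor_map u C t) = e t.
  apply: (tensor_ext (f := hom_comp (eval_map X) (tensor_map u C))) => f c.
  rewrite -[LHS]/(eval_map X (tensor_map u C _)) tensor_mapE eval_mapE.
  by rewrite -[LHS]/(e (swap C F (tens C F c f))) swapE.
apply: linear_bijective => [s|x].
  by rewrite -[s]vu evu => /(linear_bijective_ker bij_e) ->; rewrite linear0.
by have [e' _ e'K] := bij_e; exists (tensor_map u C (e' x)); rewrite evu e'K.
Qed.

End Evaluation.

Variable C : lmodType R.
Hypotheses (noethR : noetherian R) (semidualC : semidualizing C).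

(** Properness makes Hom(C, G) a flat resolution of Hom(C, M). The Bass class
    condition Tor(C, Hom(C, M)) = 0 says that it stays exact after tensoring with C,
    and evaluation identifies the outcome with G and its augmentation to M. *)
Lemma proper_flat_C_resolution_exact M (G : augmented_complex M) :
  bass_class C M -> proper_flat_C_resolution C G -> exact_complex (plus_complex G).
Proof.
move=> [bassM bij_bass] [GC properG].
pose K := complex_hom_post C (plus_complex G).
have exK : exact_complex K by exact: properG (flat_C_self C).
have GE n := flat_C_hom noethR semidualC (GC n).
have exKC : exact_complex (complex_tensor K C).
  apply: (exact_complex_tensor exK) => n n1.
  apply: (module_iso_zero (U := Tor n C (K 0))); last by have [] := bassM n n1.
  apply: (Tor_balance _ exK) => q.
  exact: exact_complex_flat (GE q).1 (@free_resolution_exact _ C).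
apply: (exact_complex_iso (X := complex_tensor K C) (Y := plus_complex G)
  (phi := fun n => eval_map C (plus_obj G n)) _ _ exKC) => [[|n]|n x].
- by apply: bij_comp bij_bass _; exists (swap _ _); exact: swapK.
- exact: (GE n).2.
exact: eval_map_natural.
Qed.

(** By [proper_flat_C_resolution_exact] G resolves M, and its terms F (x) C are acyclic for
    - (x) N, because Tor(C, N) = 0 and F is flat. So G computes the absolute Tor. *)
Lemma relative_Tor_Tor M N (G : augmented_complex M) n :
    bass_class C M -> auslander_class C N -> proper_flat_C_resolution C G ->
  module_iso (relative_Tor G N n) (Tor n N M).
Proof.
move=> bassM [auslanderN _] properG; apply: module_iso_sym.
refine (Tor_balance n (proper_flat_C_resolution_exact bassM properG) (fun q => _)).
apply: exact_complex_flat_C (properG.1 q).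
by apply: exact_complex_acyclic => m m1; have [] := auslanderN m m1.
Qed.

End RelativeTor.

Theorem proposition4p5 (R : comPzRingType) (C M N : lmodType R)
  (noethR : noetherian R) (semidualC : semidualizing C)
  (bassM : bass_class C M) (auslanderM : auslander_class C M)
  (bassN : bass_class C N) (auslanderN : auslander_class C N)
  (G : augmented_complex M) (properG : proper_flat_C_resolution C G)
  (H : augmented_complex N) (properH : proper_flat_C_resolution C H)
  (i : nat) :
  module_iso (relative_Tor G N i) (relative_Tor H M i).
Proof.
have GNM := relative_Tor_Tor noethR semidualC i bassM auslanderN properG.
have HMN := relative_Tor_Tor noethR semidualC i bassN auslanderM properH.
exact: module_iso_trans GNM (module_iso_trans (Tor_sym N M i) (module_iso_sym HMN)).
Qed.
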